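(* Let $R$ be a hemiring and let $A=(\mu_A,\lambda_A)$ be an intuitionistic fuzzy left $h$-ideal of $R$. For $x\in R$ put $\mu_A^+(x)=\mu_A(x)+1-\mu_A(0)$ and $\lambda_A^+(x)=\lambda_A(x)-\lambda_A(0)$. If $\mu_A^+(x)+\lambda_A^+(x)\le 1$ for all $x\in R$, then $A^+=(\mu_A^+,\lambda_A^+)$ is a normal intuitionistic fuzzy left $h$-ideal of $R$ containing $A$, i.e. $A\subseteq A^+$.
   Context: A hemiring $(R,+,\cdot)$ is a set with two associative operations, $+$ commutative, $\cdot$ distributing over $+$ on both sides, and an element $0$ with $0+x=x+0=x$ and $0x=x0=0$ for all $x$. An intuitionistic fuzzy set (IFS) on $R$ is a pair $A=(\mu_A,\lambda_A)$ of functions $R\to[0,1]$ with $\mu_A(x)+\lambda_A(x)\le 1$ for all $x\in R$. It is an intuitionistic fuzzy (IF) left $h$-ideal of $R$ if for all $a,b,x,y,z\in R$: (1) $\mu_A(x+y)\ge\min\{\mu_A(x),\mu_A(y)\}$; (2) $\lambda_A(x+y)\le\max\{\lambda_A(x),\lambda_A(y)\}$; (3) $\mu_A(xy)\ge\mu_A(y)$; (4) $\lambda_A(xy)\le\lambda_A(y)$; (5) $x+a+z=b+z$ implies $\mu_A(x)\ge\min\{\mu_A(a),\mu_A(b)\}$; (6) $x+a+z=b+z$ implies $\lambda_A(x)\le\max\{\lambda_A(a),\lambda_A(b)\}$. An IF left $h$-ideal $A$ is normal if $\mu_A(0)=1$ and $\lambda_A(0)=0$. For IFS $A,B$ on $R$,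 $A\subseteq B$ means $\mu_A(x)\le\mu_B(x)$ and $\lambda_A(x)\ge\lambda_B(x)$ for all $x\in R$. *)

(* Defs.v *)
From HB Require Import structures.
From mathcomp Require Import all_boot all_order all_algebra.
From mathcomp Require Import reals.

Set Implicit Arguments.
Unset Strict Implicit.
Unset Printing Implicit Defensive.

Import Order.TTheory GRing.Theory Num.Theory.

Local Open Scope ring_scope.

(* No unit is assumed, so pzSemiRingType would be too strong. *)
HB.mixin Record Nmodule_isHemiring R of GRing.Nmodule R := {
  hmul : R -> R -> R;
  hmulA : associative hmul;
  hmulDl : left_distributive hmul +%R;
  hmulDr : right_distributive hmul +%R;
  hmul0r : left_zero 0 hmul;
  hmulr0 : right_zero 0 hmul
}.

#[short(type="hemiringType")]
HB.structure Definition Hemiring :=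
  { R of Nmodule_isHemiring R & GRing.Nmodule R }.

Notation "x ** y" := (hmul x y) (at level 40, left associativity) : ring_scope.

(* A bare pair of functions; that it is an intuitionistic fuzzy set is the
   separate predicate is_ifs. *)
Record ifpair (K : realType) (R : Type) := IFPair {
  mu : R -> K;
  la : R -> K
}.

Definition is_ifs (K : realType) (R : Type) (A : ifpair K R) : Prop :=
  forall x : R,
    [/\ 0 <= mu A x <= 1, 0 <= la A x <= 1 & mu A x + la A x <= 1].

Definition ifs_subset (K : realType) (R : Type) (A B : ifpair K R) : Prop :=
  forall x : R, mu A x <= mu B x /\ la B x <= la A x.

Record is_if_left_h_ideal (K : realType) (R : hemiringType) (A : ifpair K R)
    : Prop := IFLeftHIdeal {
  ifh_ifs : is_ifs A;
  ifh_muD : forall x y : R, Num.min (mu A x) (mu A y) <= mu A (x + y);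
  ifh_laD : forall x y : R, la A (x + y) <= Num.max (la A x) (la A y);
  ifh_muM : forall x y : R, mu A y <= mu A (x ** y);
  ifh_laM : forall x y : R, la A (x ** y) <= la A y;
  ifh_mu_h : forall a b x z : R,
    x + a + z = b + z -> Num.min (mu A a) (mu A b) <= mu A x;
  ifh_la_h : forall a b x z : R,
    x + a + z = b + z -> la A x <= Num.max (la A a) (la A b)
}.

Definition is_normal_if_left_h_ideal (K : realType) (R : hemiringType)
    (A : ifpair K R) : Prop :=
  [/\ is_if_left_h_ideal A, mu A 0 = 1 & la A 0 = 0].

Definition ifplus (K : realType) (R : hemiringType) (A : ifpair K R)
    : ifpair K R :=
  IFPair (fun x => mu A x + 1 - mu A 0) (fun x => la A x - la A 0).

(* Main.v *)
Require Import Defs.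
From mathcomp Require Import all_boot all_order all_algebra.
From mathcomp Require Import reals.
From mathcomp Require Import lra.

Import Order.TTheory GRing.Theory Num.Theory.

Local Open Scope ring_scope.

(** Passing to [ifplus A] translates [mu A] by [1 - mu A 0] and [la A] by [- la A 0]. Order, min and
    max commute with translation, so every ideal inequality survives. What is left is the range
    [0,1]: since [0 ** x = 0], the ideal conditions make [mu A] maximal and [la A] minimal at 0. *)

Lemma if_left_h_ideal_mu0 (K : realType) (R : hemiringType) (A : ifpair K R) :
  is_if_left_h_ideal A -> forall x, mu A x <= mu A 0.
Proof. by move=> hA x; rewrite -(hmul0r x); apply: ifh_muM. Qed.

Lemma if_left_h_ideal_la0 (K : realType) (R : hemiringType) (A : ifpair K R) :
  is_if_left_h_ideal A -> forall x, la A 0 <= la A x.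
Proof. by move=> hA x; rewrite -(hmul0r x); apply: ifh_laM. Qed.

Lemma ifplus_is_ifs (K : realType) (R : hemiringType) (A : ifpair K R) :
  is_if_left_h_ideal A ->
  (forall x, mu (ifplus A) x + la (ifplus A) x <= 1) -> is_ifs (ifplus A).
Proof.
move=> hA hsum x; split; last exact: hsum.
(* Maximality at 0 gives the upper bound; the lower one comes from [0 <= mu A x] and [mu A 0 <= 1].
   The case of [la] is dual. *)
- have [/andP[mux0 _] _ _] := ifh_ifs hA x.
  have [/andP[_ mu01] _ _] := ifh_ifs hA 0.
  have := if_left_h_ideal_mu0 K R A hA x.
  by move=> le_mu /=; apply/andP; split; lra.
- have [_ /andP[_ lax1] _] := ifh_ifs hA x.
  have [_ /andP[la00 _] _] := ifh_ifs hA 0.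
  have := if_left_h_ideal_la0 K R A hA x.
  by move=> le_la /=; apply/andP; split; lra.
Qed.

Lemma ifplus_is_if_left_h_ideal (K : realType) (R : hemiringType)
    (A : ifpair K R) :
  is_if_left_h_ideal A ->
  (forall x, mu (ifplus A) x + la (ifplus A) x <= 1) ->
  is_if_left_h_ideal (ifplus A).
Proof.
move=> hA hsum; split; first exact: ifplus_is_ifs.
(* Regrouping exposes the common summand [1 - mu A 0], which leaves the min and cancels. *)
- by move=> x y /=; rewrite -!addrA -addr_minl lerD2r; apply: ifh_muD.
- by move=> x y /=; rewrite -addr_maxl lerD2r; apply: ifh_laD.
- by move=> x y /=; rewrite -!addrA lerD2r; apply: ifh_muM.
- by move=> x y /=; rewrite lerD2r; apply: ifh_laM.
- move=> a b x z xazE /=; rewrite -!addrA -addr_minl lerD2r.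
  exact: ifh_mu_h xazE.
- move=> a b x z xazE /=; rewrite -addr_maxl lerD2r.
  exact: ifh_la_h xazE.
Qed.

Theorem theorem17 (K : realType) (R : hemiringType) (A : ifpair K R)
    (hA : is_if_left_h_ideal A)
    (hsum : forall x : R, mu (ifplus A) x + la (ifplus A) x <= 1) :
  is_normal_if_left_h_ideal (ifplus A) /\ ifs_subset A (ifplus A).
Proof.
split.
  split; first exact: ifplus_is_if_left_h_ideal.
  - by rewrite /= addrAC subrr add0r.
  - by rewrite /= subrr.
move=> x /=.
(* Containment says that [mu] is shifted up and [la] down: [1 - mu A 0] and [la A 0] are
   nonnegative. *)
have [/andP[_ mu01] /andP[la00 _] _] := ifh_ifs hA 0.
by split; lra.
Qed.
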